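(* Let $n\ge3$ and let $\langle G\mid\mu_n\rangle$ be an $n$-ary group. Then there exist a binary group $\langle G\mid\ast,e\rangle$ on the same set $G$, with identity $e$, and, for every admissible $q$, a quasi-endomorphism $\varphi_q:G\to G$ of this binary group, such that for every admissible $q$, with $$b_q=\boldsymbol{\mu}_n^{\ell_e(q)}\bigl[e^{[[n]]_q}\bigr]=e^{\langle\ell_e(q)\rangle},$$ the following hold: (1) for all $g_1,\dots,g_n\in G$, $$\mu_n[g_1,\ldots,g_n]=g_1\ast\varphi_q^{[[1]]_q}(g_2)\ast\varphi_q^{[[2]]_q}(g_3)\ast\cdots\ast\varphi_q^{[[n-1]]_q}(g_n)\ast b_q;$$ (2) $b_q$ is a quasi-fixed point of $\varphi_q$: $\varphi_q(b_q)=b_q\ast\varphi_q(e)$; (3) the quasi-conjugation relation holds: for all $g\in G$, $$\varphi_q^{[[n-1]]_q}(g)=b_q\ast\varphi_q^{[[n-1]]_q}(e)\ast g\ast b_q^{-1},$$ where $b_q^{-1}$ is the inverse of $b_q$ in $\langle G\mid\ast,e\rangle$.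
   Context: $G$ is a non-empty set. An $n$-ary group $\langle G\mid\mu_n\rangle$ is $G$ with an operation $\mu_n:G^n\to G$ that is totally associative (in the composition of two copies of $\mu_n$ applied to $2n-1$ elements in a fixed order, the inner $\mu_n$ may be placed at any position without changing the value) and such that for every place $i=1,\dots,n$, the equation $\mu_n[u_1,\dots,u_{i-1},h,t_{i+1},\dots,t_n]=g$ has a unique solution $h\in G$ for any given $u_j,t_j,g\in G$. In polyads, $g^m$ denotes $m$ consecutive copies of $g$. The iterated product $\boldsymbol{\mu}_n^{\ell}$ is the $\ell$-fold composition of $\mu_n$ with itself, an operation on $\ell(n-1)+1$ arguments (well defined by associativity). The polyadic power is $g^{\langle \ell\rangle}=\boldsymbol{\mu}_n^{\ell}[g^{\ell(n-1)+1}]$ for $\ell\ge0$. The $q$-deformed number is $[[k]]_q=\frac{q^k-1}{q-1}=1+q+\dots+q^{k-1}$ (so $[[k]]_1=k$ and $[[0]]_q=0$). A positive integer $q$ is called admissible (for $n$) if $$\ell_\varphi(q)=\frac{q(n-2)+1}{n-1}\quad\text{and}\quad \ell_e(q)=q\,\frac{[[n-1]]_q}{n-1}$$ are both integers. Note $[[n]]_q=\ell_e(q)(n-1)+1$. A map $\varphi_q:G\to G$ is a quasi-endomorphism of a binary group $\langle G\mid\ast,e\rangle$ if $\varphi_q(g)\ast\varphi_q(h)=\varphi_q(g\ast\varphi_q(e)\ast h)$ for all $g,h\in G$. $\varphi_q^k$ is the $k$-fold composition of $\varphi_q$, with $\varphi_q^0=\mathrm{id}$. *)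

(* Defs.v *)
From mathcomp Require Import all_boot.

Set Implicit Arguments.
Unset Strict Implicit.
Unset Printing Implicit Defensive.

Section NaryGroup.
Variables (n : nat) (G : Type) (mu : n.-tuple G -> G).

(* Two ways of writing a composite mu(a, mu(t), b), i.e. two bracketings of the
   same word a ++ t ++ b, have equal values. Since w is an n-tuple, the word
   has length 2n - 1 and the inner mu stands at the place [size a]. *)
Definition totally_associative : Prop :=
  forall (a b a' b' : seq G) (t w t' w' : n.-tuple G),
    a ++ t ++ b = a' ++ t' ++ b' ->
    tval w = a ++ mu t :: b -> tval w' = a' ++ mu t' :: b' ->
    mu w = mu w'.

Definition set_place (u : n.-tuple G) (i : 'I_n) (h : G) : n.-tuple G :=
  [tuple if j == i then h else tnth u j | j < n].

(* The entry of u at the place i is irrelevant. *)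
Definition uniquely_solvable : Prop :=
  forall (i : 'I_n) (u : n.-tuple G) (g : G),
    exists! h : G, mu (set_place u i h) = g.

Definition nary_group : Prop := totally_associative /\ uniquely_solvable.

(* Left-bracketed iterated product of the word x :: s, meant for
   size s = l * (n - 1): mu is applied to the first n letters, its value
   replaces them, and so on l times. The default value x of nth is never used
   when s has that size. *)
Fixpoint iter_prod_word (l : nat) (x : G) (s : seq G) : G :=
  if l is l'.+1 then
    iter_prod_word l' (mu [tuple nth x (x :: s) i | i < n]) (drop n.-1 s)
  else x.

Definition iter_prod (l : nat) (s : (l * n.-1).+1.-tuple G) : G :=
  iter_prod_word l (thead s) (behead s).

Definition polyadic_power (l : nat) (g : G) : G :=
  iter_prod [tuple of nseq (l * n.-1).+1 g].

End NaryGroup.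

Definition qnum (q k : nat) : nat := \sum_(i < k) q ^ i.

(* The quotients l_phi(q) = (q(n-2)+1)/(n-1) and l_e(q) = q[[n-1]]_q/(n-1)
   are integers. *)
Definition admissible (n q : nat) : bool :=
  [&& 0 < q, n.-1 %| q * n.-2 + 1 & n.-1 %| q * qnum q n.-1].

Definition ell_e (n q : nat) : nat := (q * qnum q n.-1) %/ n.-1.

(* The power e^<l_e(q)> is a product of exactly [[n]]_q copies of e. *)
Lemma qnum_arity (n q : nat) :
  0 < n -> admissible n q -> qnum q n = (ell_e n q * n.-1).+1.
Proof.
case: n => // m _ /and3P[_ _ dvd_e].
rewrite /ell_e divnK //= /qnum big_ord_recl expn0 add1n big_distrr /=.
by congr _.+1; apply: eq_bigr => i _; rewrite -expnS.
Qed.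

Section BinaryGroup.
Variables (G : Type) (mul : G -> G -> G) (e : G).

(* MathComp's groupType requires a choiceType carrier; here the group
   structure lives on an arbitrary type. *)
Definition binary_group (inv : G -> G) : Prop :=
  [/\ associative mul, left_id e mul, right_id e mul,
      left_inverse e inv mul & right_inverse e inv mul].

Definition quasi_endomorphism (phi : G -> G) : Prop :=
  forall g h : G, mul (phi g) (phi h) = phi (mul (mul g (phi e)) h).

End BinaryGroup.

(* Main.v *)
Require Import Defs.
From mathcomp Require Import all_boot.
From mathcomp Require Import zify.
From Stdlib Require Import Setoid Morphisms IndefiniteDescription.

(** In Post's covering group of the n-ary group, [mu] is the product of n
letters. Fix [e] and put [g * h = g e^-1 h] and [phi_q g = e g e^-q]; these lie
in [G] because [q] is 1 modulo n - 1. Then [phi_q^k g = e^k g e^(-qk)]. Writing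
[N_k] for the q-number of [k], we have [N_(k+1) = q N_k + 1], so all powers of
[e] in the right-hand side of (1) telescope, leaving [e^(-N_n)], which
[b_q = e^(N_n)] cancels. The covering group is represented here by words over
[G] modulo the congruence "same product in every context". *)

Set Implicit Arguments.
Unset Strict Implicit.
Unset Printing Implicit Defensive.

(** * Tuples as words *)

Lemma seq_tuple (T : Type) (n : nat) (s : seq T) :
  size s = n -> exists t : n.-tuple T, tval t = s.
Proof. by move=> <-; exists (in_tuple s). Qed.

Lemma nseq_cat_cons (T : Type) (k : nat) (x : T) (s : seq T) :
  nseq k x ++ x :: s = x :: nseq k x ++ s.
Proof. by elim: k => //= k ->. Qed.

Lemma mktuple_nth (T : Type) (n : nat) (x : T) (t : n.-tuple T) :
  [tuple nth x t i | i < n] = t.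
Proof. by apply: eq_from_tnth => i; rewrite tnth_mktuple -tnth_nth. Qed.

Lemma set_place_cat (T : Type) (n : nat) (a b : seq T) (x h : T) (i : 'I_n)
    (t : n.-tuple T) :
  tval t = a ++ x :: b -> size a = i ->
  tval (set_place t i h) = a ++ h :: b.
Proof.
move=> tE ai; apply: (@eq_from_nth _ h) => [|j].
  by rewrite size_tuple -(size_tuple t) tE !size_cat.
rewrite size_tuple => jn; rewrite -(tnth_nth h _ (Ordinal jn)) tnth_mktuple.
rewrite (tnth_nth h) tE !nth_cat -val_eqE /= ai.
case: (ltngtP j i) => [//|ij|->]; last by rewrite subnn.
by rewrite -subnSK.
Qed.

(** * Products of words and the covering group *)

Section WordCongruence.
Variables (n : nat) (G : Type) (mu : n.-tuple G -> G) (x0 : G).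
Hypotheses (n_ge3 : 3 <= n) (mu_group : nary_group mu).

(* Meaningful only on words of length 1 modulo n - 1: x0 is a junk value, and
   on other words some last letters are ignored. *)
Definition wprod (s : seq G) : G :=
  if s is x :: s' then iter_prod_word mu (size s' %/ n.-1) x s' else x0.

Lemma wprod_step (w : n.-tuple G) (b : seq G) :
  wprod (w ++ b) = wprod (mu w :: b).
Proof.
have := size_tuple w; case wE: (tval w) => [|x s] /= sn; first by lia.
have sE : size s = n.-1 by rewrite -sn.
have -> : size (s ++ b) %/ n.-1 = (size b %/ n.-1).+1.
  by rewrite size_cat sE divnDl // divnn -subn1 subn_gt0 ltnW.
rewrite /= drop_cat sE ltnn subnn drop0; congr (iter_prod_word _ _ (mu _) _).
rewrite -[RHS](mktuple_nth x w); apply: eq_mktuple => i.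
by rewrite -[x :: _]/((x :: s) ++ b) nth_cat wE /= sn ltn_ord.
Qed.

(** Induction on [size a]: if [a] has n letters, multiplying its first n shortens it by n - 1.
    Otherwise the inner product meets the initial block, and total associativity on the first 2n - 1
    letters moves it to the front. *)
Lemma wprod_inner (a b : seq G) (w : n.-tuple G) :
  n.-1 %| size a + size b -> wprod (a ++ w ++ b) = wprod (a ++ mu w :: b).
Proof.
have [k] := ubnP (size a); elim: k a => // k IH a ak dvd.
have [an|na] := leqP n (size a).
  have [t tE] : exists t : n.-tuple G, tval t = take n a.
    by apply: seq_tuple; rewrite size_takel.
  rewrite -(cat_take_drop n a) -tE -!catA !wprod_step -!cat_cons IH //=.
    by rewrite size_drop; lia.
  have -> : (size (drop n a)).+1 = size a - n.-1 by rewrite size_drop; lia.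
  rewrite (_ : _ + _ = size a + size b - n.-1); last lia.
  by rewrite dvdn_sub.
have [a0|a_neq0] := eqVneq (size a) 0; last first.
  (* The divisibility makes [b] long enough for [b1] to complete [a ++ w] to 2n - 1 letters. The
     outer product of these letters is [c] when [w] is multiplied first, and [d] when the initial
     block [t] is. *)
  have ab : n.-1 <= size a + size b by apply: dvdn_leq => //; lia.
  rewrite -(cat_take_drop (n.-1 - size a) b).
  set b1 := take _ b; set b2 := drop _ b.
  have sb1 : size b1 = n.-1 - size a by rewrite size_takel //; lia.
  have [c cE] : exists c : n.-tuple G, tval c = a ++ mu w :: b1.
    by apply: seq_tuple; rewrite size_cat /= sb1; lia.
  have sc : size (a ++ w ++ b1) = n + n.-1.
    by rewrite !size_cat size_tuple sb1; lia.
  have [t tE] : exists t : n.-tuple G, tval t = take n (a ++ w ++ b1).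
    by apply: seq_tuple; rewrite size_takel // sc; lia.
  have [d dE] : exists d : n.-tuple G, tval d = mu t :: drop n (a ++ w ++ b1).
    by apply: seq_tuple; rewrite /= size_drop sc; lia.
  transitivity (wprod ((a ++ w ++ b1) ++ b2)); first by rewrite -!catA.
  rewrite -{1}(cat_take_drop n (a ++ w ++ b1)) -tE -catA wprod_step.
  rewrite -cat_cons -dE wprod_step -cat_cons catA -cE wprod_step.
  congr (wprod (_ :: _)).
  apply: (mu_group.1 [::] (drop n (a ++ w ++ b1)) a b1 t d w c) => //.
  by rewrite tE /= cat_take_drop.
by rewrite (size0nil a0); exact: wprod_step.
Qed.

(** Equality in the covering group. Only contexts in which [wprod] is meaningful are tested; the
    size condition makes these the same for [s] and [t]. *)
Definition eqw (s t : seq G) : Prop :=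
  size s = size t %[mod n.-1] /\
  forall a b, size a + size s + size b = 1 %[mod n.-1] ->
    wprod (a ++ s ++ b) = wprod (a ++ t ++ b).

Local Infix "~~~" := eqw (at level 70).

Lemma eqw_refl (s : seq G) : s ~~~ s.
Proof. by []. Qed.

Lemma eqw_context_size (s t a b : seq G) :
  size s = size t %[mod n.-1] ->
  size a + size s + size b = size a + size t + size b %[mod n.-1].
Proof.
move=> st; rewrite (addnAC _ (size s)) (addnAC _ (size t)).
by rewrite -modnDmr st modnDmr.
Qed.

Lemma eqw_sym (s t : seq G) : s ~~~ t -> t ~~~ s.
Proof.
move=> [st P]; split=> // a b ab; symmetry; apply: P.
by rewrite (eqw_context_size _ _ st).
Qed.

Lemma eqw_trans (s t u : seq G) : s ~~~ t -> t ~~~ u -> s ~~~ u.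
Proof.
move=> [st P] [tu Q]; split; first by rewrite st.
move=> a b ab; rewrite P //; apply: Q.
by rewrite -(eqw_context_size _ _ st).
Qed.

#[local] Instance eqw_equivalence : Equivalence eqw.
Proof. split; [exact: eqw_refl | exact: eqw_sym | exact: eqw_trans]. Qed.

Lemma eqw_catl (u s t : seq G) : s ~~~ t -> u ++ s ~~~ u ++ t.
Proof.
move=> [st P]; split=> [|a b]; first by rewrite !size_cat -modnDmr st modnDmr.
rewrite -!catA !(catA a) => ab; apply: P.
by rewrite -ab !size_cat !addnA.
Qed.

Lemma eqw_catr (u s t : seq G) : s ~~~ t -> s ++ u ~~~ t ++ u.
Proof.
move=> [st P]; split=> [|a b]; first by rewrite !size_cat -modnDml st modnDml.
rewrite -!catA => ab; apply: P.
by rewrite -ab !size_cat !addnA.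
Qed.

#[local] Instance cat_eqw : Proper (eqw ==> eqw ==> eqw) (@cat G).
Proof.
move=> s s' ss t t' tt.
exact: eqw_trans (eqw_catr _ ss) (eqw_catl _ tt).
Qed.

#[local] Instance cons_eqw (x : G) : Proper (eqw ==> eqw) (cons x).
Proof. by move=> s t; apply: (@eqw_catl [:: x]). Qed.

(** Taking the empty context turns congruences into equalities in G; the identities of the binary
    group and of [post_phi] are proved this way. *)
Lemma eqw_letter (x y : G) : [:: x] ~~~ [:: y] -> x = y.
Proof. by move=> [_ /(_ [::] [::] erefl)]; rewrite /= div0n. Qed.

Lemma mu_eqw (w : n.-tuple G) (s : seq G) : mu w :: s ~~~ w ++ s.
Proof.
apply: (@eqw_catr s [:: mu w]); split=> [|a b].
  by rewrite size_tuple -[LHS]modnDl addn1 prednK // (leq_trans _ n_ge3).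
move=> H; rewrite -wprod_inner // /dvdn.
move: H; rewrite /= addnAC => /eqP; rewrite -[X in _ == X %[mod _]]add0n.
by rewrite eqn_modDr mod0n.
Qed.

Lemma iter_prod_word_eqw (l : nat) (x : G) (s t : seq G) :
  size s = l * n.-1 -> iter_prod_word mu l x s :: t ~~~ x :: s ++ t.
Proof.
elim: l x s => [|l IH] x s; first by rewrite mul0n => /size0nil ->.
rewrite mulSn => sl /=; rewrite IH; last by rewrite size_drop sl addKn.
have sz : size (x :: take n.-1 s) = n.
  by rewrite /= size_takel ?sl ?leq_addr //; lia.
have [w wE] := seq_tuple sz.
have -> : [tuple nth x (x :: s) i | i < n] = w.
  rewrite -[RHS](mktuple_nth x w); apply: eq_mktuple => i.
  rewrite wE -[s in LHS](cat_take_drop n.-1) -cat_cons nth_cat sz ltn_ord //.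
by rewrite mu_eqw wE /= catA cat_take_drop.
Qed.

Lemma wprod_eqw (s t : seq G) :
  size s = 1 %[mod n.-1] -> wprod s :: t ~~~ s ++ t.
Proof.
case: s => [|x s] /= sz.
  (* The empty word, where [wprod] is junk, is excluded: 0 and 1 differ modulo n - 1, which is at
     least 2. *)
  by move: sz; rewrite mod0n modn_small //; lia.
apply: iter_prod_word_eqw; rewrite divnK // /dvdn; move/eqP: sz.
by rewrite -add1n -[X in _ == X %[mod _]]addn0 eqn_modDl mod0n.
Qed.

(** * Solvability: cancellation, neutral words and inverses *)

Lemma solve_place (a b : seq G) (g : G) :
  (size a + size b).+1 = n -> exists h, [:: g] ~~~ a ++ h :: b.
Proof.
move=> sz; have an : size a < n by lia.
have [w wE] : exists w : n.-tuple G, tval w = a ++ x0 :: b.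
  by apply: seq_tuple; rewrite size_cat /= addnS.
have [h [hE _]] := mu_group.2 (Ordinal an) w g.
exists h; rewrite -hE mu_eqw (set_place_cat h wE) //.
by rewrite cats0.
Qed.

Lemma cancel_prefix (a : seq G) (h k : G) :
  size a = n.-1 -> a ++ [:: h] ~~~ a ++ [:: k] -> h = k.
Proof.
move=> sz; have an : size a < n by lia.
have [w wE] : exists w : n.-tuple G, tval w = a ++ [:: x0].
  by apply: seq_tuple; rewrite size_cat /= sz; lia.
set i := Ordinal an.
have [l [_ uniq]] := mu_group.2 i w (mu (set_place w i k)).
move=> hk; rewrite -(uniq k erefl); symmetry; apply: uniq; apply: eqw_letter.
by rewrite !mu_eqw !(set_place_cat _ wE) // !cats0.
Qed.

(* Every letter has the form u x, so s is neutral on the right of all letters.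
   Hence s s = s, and s is neutral on the left by cancellation. *)
Lemma neutral_word (x : G) (s : seq G) :
  size s = n.-1 -> x :: s ~~~ [:: x] -> s ~~~ [::].
Proof.
move=> sz xs.
have ys y : y :: s ~~~ [:: y].
  (* Solving at the first place gives y = h x^(n-1); [rcons] exposes the last x, which absorbs
     [s]. *)
  have [|h hE] := @solve_place [::] (rcons (nseq n.-2 x) x) y.
    by rewrite /= size_rcons size_nseq; lia.
  change ([:: y] ++ s ~~~ [:: y]); rewrite hE /= -cats1 -catA.
  by rewrite /= xs.
have sy y : s ++ [:: y] ~~~ [:: y].
  have [w wE] : exists w : n.-tuple G, tval w = s ++ [:: y].
    by apply: seq_tuple; rewrite size_cat /= sz; lia.
  have wy : [:: mu w] ~~~ s ++ [:: y] by rewrite mu_eqw wE cats0.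
  suff wE' : mu w = y by rewrite -wy wE'.
  apply: (cancel_prefix sz); rewrite wy.
  case: (lastP s) sz ys => [|s' z] sz' ys; first by move: sz' => /=; lia.
  rewrite -!cats1 -!catA /=; have := ys z; rewrite -cats1 => ys'.
  suff -> : z :: s' ++ z :: [:: y] ~~~ [:: z; y] by [].
  by have := eqw_catr [:: y] ys'; rewrite /= -catA.
split=> [|a b]; first by rewrite sz modnn mod0n.
(* An empty context would leave total size n - 1, not 1 modulo n - 1. So [s] has a neighbouring
   letter, which absorbs it. *)
case: (lastP a) => [|a' y].
  case: b => [|y b] /=; first by rewrite sz addn0 modnn modn_small //; lia.
  move=> sab; have [_ /(_ [::] b)] := sy y; rewrite -!catA; apply.
  by rewrite -sab size_cat /=; congr (_ %% _); lia.
have [_ /(_ a' b) ab] := ys y; rewrite -!cats1 -!catA size_cat => sab.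
by apply: ab; rewrite -sab /=; congr (_ %% _); lia.
Qed.

(** The length n - 2 is -1 modulo n - 1, so an inverse word between two letters makes a word of n
    letters. *)
Definition inverse_word (x : G) (s : seq G) : Prop :=
  [/\ size s = n.-2, x :: s ~~~ [::] & s ++ [:: x] ~~~ [::]].

(** Solving y^(n-1) h = y makes y^(n-2) h neutral, so y^(n-3) h is a right inverse of y. Then every
    word has a right inverse, and as in any monoid right inverses are two-sided. *)
Lemma exists_inverse_word (x : G) : exists s, inverse_word x s.
Proof.
have right_inverse y : exists2 s, size s = n.-2 & y :: s ~~~ [::].
  have [|h] := @solve_place (nseq n.-1 y) [::] y.
    by rewrite size_nseq addn0 prednK // (leq_trans _ n_ge3).
  (* Two letters y are split off: one to absorb the neutral word, one to begin it. *)
  have -> : n.-1 = n.-2.-1.+2 by lia.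
  rewrite /= => hE; exists (nseq n.-2.-1 y ++ [:: h]).
    by rewrite size_cat size_nseq /=; lia.
  apply: (@neutral_word y); last by rewrite -hE.
  by rewrite /= size_cat size_nseq /=; lia.
have right_inverse_seq t : exists r, t ++ r ~~~ [::].
  elim: t => [|y t [r rE]]; first by exists [::].
  have [s _ sE] := right_inverse y; exists (r ++ s).
  by rewrite cat_cons catA rE.
have [s ss xs] := right_inverse x; exists s; split=> //.
have [r sr] := right_inverse_seq s.
have xr : [:: x] ~~~ r.
  transitivity (x :: s ++ r); first by rewrite sr.
  exact: (eqw_catr r xs).
by rewrite xr.
Qed.

(** * The binary group and the maps phi_q *)

Section Operations.
Variables (e : G) (winv : G -> seq G).
Hypothesis winvP : forall x, inverse_word x (winv x).

Definition einv_pow (k : nat) : seq G := flatten (nseq k (winv e)).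

Definition post_mul (x y : G) : G := wprod (x :: winv e ++ [:: y]).

(** This is e x^-1 e, since x e^-1 (e x^-1 e) = e. *)
Definition post_inv (x : G) : G := wprod (e :: winv x ++ [:: e]).

Definition post_phi (q : nat) (x : G) : G := wprod (e :: x :: einv_pow q).

Lemma winv_cancelr (x : G) (s : seq G) : x :: winv x ++ s ~~~ s.
Proof. by have [_ /(eqw_catr s)] := winvP x. Qed.

Lemma winv_cancell (x : G) (s : seq G) : winv x ++ x :: s ~~~ s.
Proof. by have [_ _ /(eqw_catr s)] := winvP x; rewrite -catA. Qed.

Lemma einv_powD (j k : nat) : einv_pow (j + k) = einv_pow j ++ einv_pow k.
Proof. by rewrite /einv_pow nseqD flatten_cat. Qed.

Lemma einv_powS (k : nat) : einv_pow k.+1 = winv e ++ einv_pow k.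
Proof. by []. Qed.

Lemma einv_powSr (k : nat) : einv_pow k.+1 = einv_pow k ++ winv e.
Proof. by rewrite -addn1 einv_powD /einv_pow /= cats0. Qed.

Lemma size_einv_pow (k : nat) : size (einv_pow k) = k * n.-2.
Proof.
have [sE _ _] := winvP e.
by elim: k => // k IH; rewrite einv_powS size_cat sE IH.
Qed.

Lemma einv_pow_cancelr (k : nat) (s : seq G) :
  nseq k e ++ einv_pow k ++ s ~~~ s.
Proof.
elim: k s => // k IH s.
by rewrite einv_powSr /= -catA IH winv_cancelr.
Qed.

Lemma einv_pow_cancell (k : nat) (s : seq G) :
  einv_pow k ++ nseq k e ++ s ~~~ s.
Proof.
elim: k s => // k IH s.
by rewrite einv_powSr /= -catA winv_cancell IH.
Qed.

Lemma size_winv_cat (x y z : G) : size (x :: winv y ++ [:: z]) = 1 %[mod n.-1].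
Proof.
have [sE _ _] := winvP y.
by rewrite /= size_cat sE -[RHS]modnDl /=; congr (_ %% _); lia.
Qed.

Lemma post_mul_eqw (x y : G) (s : seq G) :
  post_mul x y :: s ~~~ x :: winv e ++ y :: s.
Proof. by rewrite wprod_eqw ?size_winv_cat //= -catA. Qed.

Lemma post_inv_eqw (x : G) (s : seq G) :
  post_inv x :: s ~~~ e :: winv x ++ e :: s.
Proof. by rewrite wprod_eqw ?size_winv_cat //= -catA. Qed.

Lemma post_group : binary_group post_mul e post_inv.
Proof.
split=> [x y z|x|x|x|x]; apply: eqw_letter.
- by rewrite !post_mul_eqw.
- by rewrite post_mul_eqw winv_cancelr.
- by rewrite post_mul_eqw winv_cancell.
- by rewrite post_mul_eqw post_inv_eqw winv_cancelr winv_cancell.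
- by rewrite post_mul_eqw post_inv_eqw winv_cancell winv_cancelr.
Qed.

(** * Identities for an admissible q *)

Section Admissible.
Variable q : nat.
Hypothesis q_adm : admissible n q.

(** The word has q(n - 2) + 2 letters, which is 1 modulo n - 1 because l_phi(q) is an integer. *)
Lemma post_phi_eqw (x : G) (s : seq G) :
  post_phi q x :: s ~~~ e :: x :: einv_pow q ++ s.
Proof.
apply: wprod_eqw.
have /and3P[_ /eqP phi_int _] := q_adm.
have -> : size (e :: x :: einv_pow q) = 1 + (q * n.-2 + 1).
  by rewrite /= size_einv_pow; lia.
by rewrite -modnDmr phi_int.
Qed.

Lemma iter_post_phi_eqw (k : nat) (x : G) (s : seq G) :
  iter k (post_phi q) x :: s ~~~ nseq k e ++ x :: einv_pow (q * k) ++ s.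
Proof.
elim: k s => [|k IH] s; first by rewrite muln0.
by rewrite /= post_phi_eqw IH mulnSr einv_powD -catA.
Qed.

Lemma post_phi_quasi_endo : quasi_endomorphism post_mul e (post_phi q).
Proof.
move=> g h; apply: eqw_letter.
rewrite !(post_mul_eqw, post_phi_eqw) !winv_cancell.
rewrite (catA (einv_pow q) (winv e)) -einv_powSr einv_powS -catA.
by rewrite winv_cancelr.
Qed.

Lemma qnumS (k : nat) : qnum q k.+1 = (q * qnum q k).+1.
Proof.
rewrite /qnum big_ord_recl expn0 add1n big_distrr /=.
by congr _.+1; apply: eq_bigr => i _; rewrite -expnS.
Qed.

(** The offset [j] is what the induction shifts when the first factor is split off. The final [e]
    comes from the empty product. *)
Lemma big_post_mul_eqw (k : nat) (g : 'I_k -> G) (j : nat) (s : seq G) :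
  \big[post_mul/e]_(i < k) iter (qnum q (j + i)) (post_phi q) (g i) :: s ~~~
  nseq (qnum q j) e ++ [seq g i | i <- enum 'I_k]
    ++ einv_pow (qnum q (j + k)) ++ e :: s.
Proof.
elim: k g j s => [|k IH] g j s.
  by rewrite big_ord0 enum_ord0 addn0 /= einv_pow_cancelr.
rewrite big_ord_recl addn0 post_mul_eqw iter_post_phi_eqw.
under eq_bigr do rewrite /= /bump add1n -addSnnS.
(* Between two factors, e^(-q N_j) e^-1 = e^(-N_(j+1)) cancels the e^(N_(j+1)) of the induction
   hypothesis. *)
rewrite IH qnumS (catA (einv_pow _) (winv e)) -einv_powSr einv_pow_cancell.
by rewrite enum_ordSl /= -map_comp addSnnS.
Qed.

Let b := polyadic_power mu (ell_e n q) e.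

(** Integrality of l_e(q) enters here, through [qnum_arity]. *)
Lemma polyadic_power_eqw (s : seq G) : b :: s ~~~ nseq (qnum q n) e ++ s.
Proof.
rewrite (qnum_arity _ q_adm) ?(leq_trans _ n_ge3) //=.
rewrite /b /polyadic_power /iter_prod.
by rewrite iter_prod_word_eqw //= ?size_nseq.
Qed.

Lemma mu_post_mul (g : n.-tuple G) :
  mu g = post_mul
    (\big[post_mul/e]_(i < n) iter (qnum q i) (post_phi q) (tnth g i)) b.
Proof.
apply: eqw_letter; rewrite mu_eqw post_mul_eqw.
(* At offset 0 no initial power of e remains, as N_0 = 0. *)
rewrite (big_post_mul_eqw (tnth g) 0) /qnum big_ord0 /= -/(qnum q _) add0n.
rewrite winv_cancelr polyadic_power_eqw einv_pow_cancell.
by rewrite map_tnth_enum.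
Qed.

(** As b_q is a power of e, it commutes with e: both sides are e^(N_n + 1) e^-q. *)
Lemma post_phi_quasi_fixed : post_phi q b = post_mul b (post_phi q e).
Proof.
apply: eqw_letter; rewrite !(post_mul_eqw, post_phi_eqw) winv_cancell.
by rewrite !polyadic_power_eqw nseq_cat_cons.
Qed.

Lemma post_phi_quasi_conj (g : G) :
  iter (qnum q n.-1) (post_phi q) g =
  post_mul (post_mul (post_mul b (iter (qnum q n.-1) (post_phi q) e)) g)
    (post_inv b).
Proof.
have [mulA _ mulr1 _ mulrV] := post_group.
set k := qnum q n.-1.
(* Multiplying by b_q on the right removes its inverse; since N_n = qk + 1, both sides then reduce
   to e^k g. *)
suff <- : post_mul (iter k (post_phi q) g) b
    = post_mul (post_mul b (iter k (post_phi q) e)) g.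
  by rewrite -mulA mulrV mulr1.
apply: eqw_letter; rewrite !(post_mul_eqw, iter_post_phi_eqw).
have nE : qnum q n = (q * k).+1 by rewrite -qnumS prednK // (leq_trans _ n_ge3).
rewrite !polyadic_power_eqw nE nseq_cat_cons winv_cancell.
rewrite !(catA (einv_pow _) (winv e)) -einv_powSr einv_pow_cancell.
by rewrite (catA (nseq _ _)) -nseqD addnC nseqD -catA einv_pow_cancelr.
Qed.

End Admissible.
End Operations.
End WordCongruence.

Theorem theorem4p2 (n : nat) (G : Type) (mu : n.-tuple G -> G)
    (n_ge3 : 3 <= n) (G_nonempty : inhabited G) (mu_group : nary_group mu) :
  exists (mul : G -> G -> G) (e : G) (inv : G -> G) (phi : nat -> G -> G),
    [/\ binary_group mul e inv,
        forall q : nat, admissible n q -> quasi_endomorphism mul e (phi q)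
      & forall q : nat, admissible n q ->
          let b := polyadic_power mu (ell_e n q) e in
          [/\ forall g : n.-tuple G,
                mu g =
                mul (\big[mul/e]_(i < n) iter (qnum q i) (phi q) (tnth g i)) b,
              phi q b = mul b (phi q e)
            & forall g : G,
                iter (qnum q n.-1) (phi q) g =
                mul (mul (mul b (iter (qnum q n.-1) (phi q) e)) g) (inv b)]].
Proof.
have [e] := G_nonempty.
(* Choice fixes one inverse word for every letter. *)
have [winv winvP] :=
  functional_choice _ (exists_inverse_word e n_ge3 mu_group).
(* The first [e] is the junk value [x0], the second the identity. *)
exists (post_mul mu e e winv), e.
exists (post_inv mu e e winv), (post_phi mu e e winv).
split=> [|q q_adm|q q_adm b].
- exact: post_group.
- exact: post_phi_quasi_endo.
- split=> [g||g].
  + exact: mu_post_mul.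
  + exact: post_phi_quasi_fixed.
  + exact: post_phi_quasi_conj.
Qed.
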